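(* Let $\mathcal{H}$ be a nonempty hypergraph such that $\chi(\operatorname{KG}(\mathcal{H}))=\operatorname{cd}_2(\mathcal{H})$. Then $\chi(\operatorname{KG}(\mathcal{H}))=\chi_c(\operatorname{KG}(\mathcal{H}))$.
   Context: A hypergraph $\mathcal{H}$ is a pair $(V(\mathcal{H}),E(\mathcal{H}))$ where $V(\mathcal{H})$ is a nonempty finite set and $E(\mathcal{H})$ is a finite collection of (nonempty) subsets of $V(\mathcal{H})$. It is nonempty if it has at least one edge. The general Kneser graph $\operatorname{KG}(\mathcal{H})$ has the edges of $\mathcal{H}$ as vertices, two of them being adjacent if they are disjoint as sets. $\chi$ is the chromatic number. A hypergraph is $2$-colorable if its vertices can be colored with $2$ colors so that no edge is monochromatic. The $2$-colorability defect is $\operatorname{cd}_2(\mathcal{H})=\min\{|U| : U\subseteq V(\mathcal{H}),\ (V(\mathcal{H})\setminus U,\{e\in E(\mathcal{H}): e\cap U=\varnothing\})\text{ is }2\text{-colorable}\}$. For a graph $G=(V,E)$ and integers $p\ge q\ge 1$, a $(p,q)$-coloring of $G$ is a mapping $c:V\to\{1,\ldots,p\}$ such that $q\le|c(u)-c(v)|\le p-q$ for every edge $uv$ of $G$. The circular chromatic number of $G$ is $\chi_c(G)=\inf\{p/q: G\text{ admits a }(p,q)\text{-coloring}\}$. *)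

(* Defs.v *)
From HB Require Import structures.
From mathcomp Require Import all_boot all_order all_algebra.

Set Implicit Arguments.
Unset Strict Implicit.
Unset Printing Implicit Defensive.

Import Order.TTheory GRing.Theory Num.Theory.

Record hypergraph := Hypergraph {
  hvert : finType;
  hedges : {set {set hvert}};
  hvert_gt0 : 0 < #|hvert|;
  hedges_neq0 : set0 \notin hedges
}.

Record sgraph := SGraph {
  svertex :> finType;
  sadj : rel svertex;
  sadj_sym : symmetric sadj;
  sadj_irr : irreflexive sadj
}.

Section KneserGraph.
Variable H : hypergraph.

Definition kneser_vertex : finType := {e : {set hvert H} | e \in hedges H}.

Definition kneser_adj : rel kneser_vertex :=
  fun e f => [disjoint val e & val f].

Lemma kneser_adj_sym : symmetric kneser_adj.
Proof. by move=> e f; rewrite /kneser_adj disjoint_sym. Qed.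

Lemma kneser_adj_irr : irreflexive kneser_adj.
Proof.
move=> e; rewrite /kneser_adj -setI_eq0 setIid.
by apply: contraNF (hedges_neq0 H) => /eqP <-; exact: (valP e).
Qed.

Definition KG : sgraph := SGraph kneser_adj_sym kneser_adj_irr.
End KneserGraph.

Definition colorable (G : sgraph) (k : nat) : bool :=
  [exists c : {ffun G -> 'I_k},
    [forall u, forall v, sadj u v ==> (c u != c v)]].

Lemma ex_colorable (G : sgraph) : exists k, colorable G k.
Proof.
exists #|G|; apply/existsP; exists [ffun u => enum_rank u].
apply/forallP => u; apply/forallP => v; apply/implyP => uv.
rewrite !ffunE (inj_eq enum_rank_inj).
by apply: contraTneq uv => ->; rewrite sadj_irr.
Qed.

Definition chi (G : sgraph) : nat := ex_minn (ex_colorable G).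

(* [(W, F)] is a set system whose vertex set [W] may be empty; every member of
   [F] is meant to be a subset of [W]. *)
Definition two_colorable (T : finType) (W : {set T}) (F : {set {set T}})
    : bool :=
  [exists c : {ffun {x : T | x \in W} -> bool},
    [forall e in F, exists x, exists y,
      [&& val x \in e, val y \in e & c x != c y]]].

Definition cd2_witness (H : hypergraph) (U : {set hvert H}) : bool :=
  two_colorable (~: U) [set e in hedges H | e :&: U == set0].

Lemma ex_cd2_witness (H : hypergraph) :
  exists n, [exists U : {set hvert H}, (#|U| == n) && cd2_witness U].
Proof.
exists #|[set: hvert H]|; apply/existsP; exists [set: hvert H].
rewrite eqxx; apply/existsP; exists [ffun=> true].
apply/forallP => e; rewrite inE setIT; apply/implyP => /andP[eH /eqP e0].
by move: (hedges_neq0 H); rewrite -e0 eH.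
Qed.

Definition cd2 (H : hypergraph) : nat := ex_minn (ex_cd2_witness H).

(* The truncated subtraction [p - q] is exact whenever [q <= p], as required in
   [chi_c]; [`|c u - c v|] is the distance between naturals. *)
Definition pq_coloring (G : sgraph) (p q : nat) (c : G -> nat) : Prop :=
  (forall v, 1 <= c v <= p) /\
  (forall u v, sadj u v -> q <= `|c u - c v|%N <= p - q).

(* Imported only here, because [classical_sets] shadows names of [finset] such
   as [set0]. *)
From mathcomp Require Import classical_sets reals.

Definition chi_c (R : realType) (G : sgraph) : R :=
  inf [set x : R | exists p q : nat,
    [/\ 1 <= q <= p,
        exists c : G -> nat, pq_coloring p q c
      & x = (p%:R / q%:R)%R]]%classic.

(* Main.v *)
Require Import Defs.
From mathcomp Require Import all_boot all_order all_algebra.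
From mathcomp Require Import reals.
From mathcomp Require Import zify.

Set Implicit Arguments.
Unset Strict Implicit.
Unset Printing Implicit Defensive.

(* Let t = cd_2(H), let c be a proper t-coloring of KG(H) and n = |V(H)|.  An
   antipodal sign function on the nonzero vectors of {+,-,0}^n always has an odd
   number of maximal chains along which the signs alternate starting with +
   (Fan's lemma for labels whose absolute values increase along chains).
   Give a vector X with an edge in its positive or negative part the sign of the
   part containing an edge of largest color; this covers all X of size > n - t,
   while signs of edge-free vectors are free.  Along an alternating chain the
   largest color increases strictly, hence takes the values 0, .., t-1 exactly on
   the last t members.  A suitable choice of the free signs at size n - t then
   yields an edge-free Z = (Z+, Z-) of size n - t from which alternating
   continuations to the top of both kinds start.  Climbing them in parallel, both
   add the same element x_i at step i, and all edges in Z+ + x_i or Z- + x_i have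
   color i.  This gives edges e_i, f_i of color i with e_i disjoint from f_j for
   i <> j.
   If there were a (p,q)-coloring d with p < tq, take the coloring
   floor((d - 1)/q): then d(e_(i+1)) >= d(f_i) + q and d(f_(i+1)) >= d(e_i) + q,
   so the differences d(e_(t-1)) - d(f_0) and d(f_(t-1)) - d(e_0), both at most
   p - q, add up to at least 2(t-1)q, a contradiction. *)

(** * Alternating chains of sign vectors *)

Section AlternatingChains.
Variables (T : finType) (s : {set T} -> {set T} -> bool).
Implicit Types (E B : {set T}) (b : bool).

(* The pair (E, B) with B a subset of E encodes the sign vector with support E
   and positive part B.  [altpar b k E B], for #|E| = k, is the parity of the
   number of saturated chains from the empty vector (excluded) to (E, B) whose
   signs alternate, starting with [b]. *)
Fixpoint altpar b k E B : bool :=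
  if k is k'.+1 then
    (s E B == b (+) odd k')
      && \big[addb/false]_(x in E) altpar b k' (E :\ x) (B :\ x)
  else true.
Arguments altpar : simpl never.

Lemma altparS b k E B : altpar b k.+1 E B = (s E B == b (+) odd k)
  && \big[addb/false]_(x in E) altpar b k (E :\ x) (B :\ x).
Proof. by []. Qed.

(** Swapping the two indices matches the ordered pairs, so the terms cancel mod 2. *)
Lemma big_addb_sym (P : pred T) (F : T -> T -> bool) :
  (forall x y, F x y = F y x) ->
  \big[addb/false]_(x | P x) \big[addb/false]_(y | (y != x) && P y) F x y
    = false.
Proof.
move=> Fsym; rewrite pair_big_dep /=.
rewrite (bigID (fun u : T * T => enum_rank u.1 < enum_rank u.2)) /=.
rewrite [X in _ (+) X](reindex_inj (h := fun u : T * T => (u.2, u.1))) /=; last first.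
  by move=> [x y] [x' y'] [-> ->].
rewrite [X in _ (+) X](eq_big
  (fun u : T * T => (P u.1 && ((u.2 != u.1) && P u.2))
     && (enum_rank u.1 < enum_rank u.2)) (fun u => F u.1 u.2)) ?addbb //.
move=> [x y] /=; rewrite -leqNgt leq_eqVlt (eq_sym x).
have -> : (nat_of_ord (enum_rank x) == enum_rank y) = (y == x).
  by rewrite eq_sym -(inj_eq enum_rank_inj).
by case: (P x); case: (P y); case: (y == x).
Qed.

Lemma setDDK E B : B \subset E -> E :\: (E :\: B) = B.
Proof. by move=> BE; rewrite setDDr setDv set0U (setIidPr BE). Qed.

Lemma setDD1 E B x : (E :\: B) :\ x = (E :\ x) :\: (B :\ x).
Proof.
by apply/setP => y; rewrite !inE; case: (y == x); rewrite ?andbF.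
Qed.

Lemma setD1AC E x y : E :\ x :\ y = E :\ y :\ x.
Proof. by rewrite !setDDl setUC. Qed.

Lemma cardsD1_pred E x k : #|E| = k.+1 -> x \in E -> #|E :\ x| = k.
Proof. by move=> cE xE; move: cE; rewrite (cardsD1 x) xE => -[]. Qed.

(* The boundary identity mod 2: among the alternating chains obtained from
   maximal chains by deleting one member, those that miss a member other than
   the top one cancel in pairs. *)
Lemma altpar_boundary k E B : #|E| = k.+1 ->
  altpar true k.+1 E B (+) altpar false k.+1 E B
    = \big[addb/false]_(x in E) altpar true k (E :\ x) (B :\ x).
Proof.
elim: k E B => [|k IH] E B cE.
  by rewrite !altparS; case: (s E B); rewrite /= ?addbF.
(* By induction on each facet, the two sums differ by a double sum that is symmetric in the two
   removed elements. *)
have eqs : \big[addb/false]_(x in E) altpar true k.+1 (E :\ x) (B :\ x)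
    = \big[addb/false]_(x in E) altpar false k.+1 (E :\ x) (B :\ x).
  apply/eqP; rewrite -[_ == _]negbK -negb_add negbK -big_split /=; apply/negbT.
  rewrite -[RHS](@big_addb_sym (mem E)
    (fun x y => altpar true k (E :\ x :\ y) (B :\ x :\ y))); last first.
    by move=> x y; rewrite [E :\ x :\ y]setD1AC [B :\ x :\ y]setD1AC.
  apply: eq_bigr => x xE; rewrite IH ?(cardsD1_pred cE) //.
  by apply: eq_bigl => y; rewrite !inE.
rewrite 2!altparS eqs.
move: (\big[_/_]_(x in E) altpar false _ _ _) => P.
by case: (s E B); case: P => /=; case: odd.
Qed.

Hypothesis s_anti : forall E B, B \subset E -> E != set0 ->
  s E (E :\: B) = ~~ s E B.

Lemma altpar_anti b k E B : B \subset E -> #|E| = k ->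
  altpar b k E (E :\: B) = altpar (~~ b) k E B.
Proof.
elim: k E B => [|k IH] E B BE cE //.
rewrite !altparS.
rewrite s_anti -?card_gt0 ?cE //; congr (_ && _).
  by case: (s E B); case: (b); case: odd.
apply: eq_bigr => x xE; rewrite setDD1 IH ?setSD //.
by rewrite (cardsD1_pred cE).
Qed.

(** Fix [v] in [E]. Antipodality folds the vectors with negative [v] onto those with positive [v],
    which turns the sum into a sum of boundaries. A facet dropping [x <> v] occurs once for each
    sign of [x] and cancels; dropping [v] leaves the same sum for [E :\ v]. *)
Lemma altpar_total k E : #|E| = k ->
  \big[addb/false]_(B : {set T} | B \subset E) altpar true k E B.
Proof.
elim: k E => [|k IH] E cE.
  rewrite (big_pred1 set0) // => B.
  by rewrite (cards0_eq cE) subset0.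
have [v vE] : exists v, v \in E by apply/set0Pn; rewrite -card_gt0 cE.
rewrite (bigID (fun B => v \in B)) /=.
rewrite [X in _ (+) X](_ : _ = \big[addb/false]_(B : {set T} |
    (B \subset E) && (v \in B)) altpar false k.+1 E B); last first.
  rewrite (reindex_onto (fun B => E :\: B) (fun B => E :\: B)) /=; last first.
    by move=> B /andP[BE _]; rewrite setDDK.
  apply: eq_big => [B|B /andP[_ /eqP EB]].
    rewrite subsetDl !inE vE andbT negbK; apply/andP/andP=> -[].
      by move=> /= -> /eqP <-; rewrite subsetDl.
    by move=> BE ->; rewrite setDDK.
  have BE : B \subset E by rewrite -EB subsetDl.
  by rewrite altpar_anti.
rewrite -big_split /= (eq_bigr (fun B => \big[addb/false]_(x in E)
   altpar true k (E :\ x) (B :\ x))); last first.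
  by move=> B _; rewrite -altpar_boundary.
rewrite exchange_big /= (bigD1 v) //= [X in _ (+) X]big1 ?addbF; last first.
  move=> x /andP[xE xv]; rewrite (bigID (fun B => x \in B)) /=.
  rewrite [X in X (+) _](reindex_onto (fun B => x |: B) (fun B => B :\ x)) /=.
    rewrite [X in X (+) _](eq_big (fun B : {set T} =>
       ((B \subset E) && (v \in B)) && (x \notin B))
       (fun B => altpar true k (E :\ x) (B :\ x))) ?addbb // => B.
      rewrite subUset sub1set xE !inE eqxx [v == x]eq_sym (negPf xv) /= andbT.
      congr (_ && _); apply/eqP/idP => [<-|xB]; first by rewrite !inE eqxx.
      by rewrite setU1K.
    move=> /andP[_ /eqP eB]; rewrite -[in RHS]eB.
    by rewrite setDDl setUid.
  by move=> B /andP[_ xB]; rewrite setD1K.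
rewrite (reindex_onto (fun B => v |: B) (fun B => B :\ v)) /=; last first.
  by move=> B /andP[_ xB]; rewrite setD1K.
rewrite (eq_big (fun B : {set T} => B \subset E :\ v)
   (fun B => altpar true k (E :\ v) B)) ?IH ?(cardsD1_pred cE) // => B.
  rewrite subUset sub1set vE !inE eqxx /= andbT subsetD1.
  congr (_ && _); apply/eqP/idP => [<-|xB]; first by rewrite !inE eqxx.
  by rewrite setU1K.
by move=> /andP[_ /eqP ->].
Qed.

(* Existence of a saturated chain with [k] members strictly above (E, B) whose
   signs alternate, starting with [b]. *)
Fixpoint altup (b : bool) k E B : bool :=
  if k is k'.+1 then
    [exists x in ~: E, exists C : {set T},
      [&& C \subset x |: E, C :\ x == B, s (x |: E) C == b
        & altup (~~ b) k' (x |: E) C]]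
  else true.

(** An odd sum has a true term, so members can be moved one by one from the counted chain to the
    continuation above it. *)
Lemma altpar_descend d k m b E B : #|E| = m + d -> B \subset E ->
  altpar b (m + d) E B -> altup (b (+) odd (m + d)) k E B ->
  exists E', exists B', [/\ #|E'| = m, B' \subset E', altpar b m E' B'
    & altup (b (+) odd m) (d + k) E' B'].
Proof.
elim: d k E B => [|d IH] k E B; first by rewrite addn0; exists E, B.
rewrite addnS altparS => cE BE /andP[sE pE] uE.
have [x xE px] : exists2 x, x \in E & altpar b (m + d) (E :\ x) (B :\ x).
  apply/exists_inP; rewrite -[X in is_true X]negbK; apply/negP => /exists_inPn px.
  by move: pE; rewrite big1 // => x xE; apply: negbTE; exact: px.
rewrite addSnnS; apply: (IH k.+1 (E :\ x) (B :\ x)) => //.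
- exact: cardsD1_pred.
- exact: setSD.
apply/exists_inP; exists x; first by rewrite !inE eqxx.
apply/existsP; exists B; rewrite setD1K // BE eqxx sE /=.
by move: uE; rewrite /= addbN.
Qed.

Lemma fan_sign n m : #|T| = n -> m <= n ->
  exists E, exists B, [/\ #|E| = m, B \subset E, altpar true m E B
    & altup (~~ odd m) (n - m) E B].
Proof.
move=> cT mn.
have [B] : exists B : {set T}, altpar true n [set: T] B.
  apply/existsP; rewrite -[X in is_true X]negbK; apply/negP => /existsPn pB.
  have := @altpar_total n [set: T]; rewrite cardsT cT big1 => [/(_ erefl)//|].
  by move=> B _; apply: negbTE; exact: pB.
move=> pB; have := @altpar_descend (n - m) 0 m true [set: T] B.
by rewrite addn0 subnKC // cardsT cT; apply=> //; rewrite subsetT.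
Qed.

End AlternatingChains.

(** * Colorful bicliques *)

Section ColorfulSubgraph.
Variables (T G : finType) (edge : G -> {set T}) (t : nat) (c : G -> nat).
Local Notation gap := (#|T| - t).
Implicit Types (E B C : {set T}) (b : bool) (e f : G).

Hypothesis edge_neq0 : forall e, edge e != set0.
Hypothesis c_lt : forall e, c e < t.
Hypothesis c_proper : forall e f, [disjoint edge e & edge f] -> c e != c f.

Definition side b E B := if b then B else E :\: B.

Definition inside E B e := (edge e \subset B) || (edge e \subset E :\: B).

Hypothesis inside_ex : forall E B, B \subset E -> gap < #|E| ->
  exists e, inside E B e.

(** The shift by one reserves 0 for sign vectors without edges in either part. *)
Definition maxcol E B := \max_(e | inside E B e) (c e).+1.

Definition topsign E B :=
  [exists e : G, (edge e \subset B) && ((c e).+1 == maxcol E B)].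

Lemma side_inside b E B e : edge e \subset side b E B -> inside E B e.
Proof. by rewrite /inside; case: b => /= ->; rewrite ?orbT. Qed.

Lemma inside_side E B e : inside E B e -> exists b, edge e \subset side b E B.
Proof. by case/orP; [exists true | exists false]. Qed.

Lemma maxcol_gt E B e : inside E B e -> c e < maxcol E B.
Proof. exact: (@leq_bigmax_cond _ (inside E B) (fun e => (c e).+1)). Qed.

Lemma maxcol_attained E B : 0 < maxcol E B ->
  exists2 e, inside E B e & (c e).+1 = maxcol E B.
Proof.
move=> m0; have i0 : 0 < #|inside E B|.
  rewrite lt0n; apply: contraTneq m0 => /eqP; rewrite -/(pred0b _) => /pred0P i0.
  by rewrite /maxcol big_pred0.
by have [e eI eM] := eq_bigmax_cond (fun e => (c e).+1) i0; exists e.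
Qed.

Lemma maxcol_le E B : maxcol E B <= t.
Proof. by apply/bigmax_leqP. Qed.

Lemma maxcol_large E B : B \subset E -> gap < #|E| -> 0 < maxcol E B.
Proof. by move=> BE /(inside_ex BE)[e /maxcol_gt]; apply: leq_trans. Qed.

Lemma sideD b E B : B \subset E -> side b E (E :\: B) = side (~~ b) E B.
Proof. by move=> BE; case: b => //=; rewrite setDDK. Qed.

Lemma inside_anti E B : B \subset E -> inside E (E :\: B) =1 inside E B.
Proof.
move=> BE e; rewrite /inside orbC.
by have /= -> := @sideD false _ _ BE.
Qed.

Lemma maxcol_anti E B : B \subset E -> maxcol E (E :\: B) = maxcol E B.
Proof. by move=> BE; apply: eq_bigl; apply: inside_anti. Qed.

Lemma side_disjoint b E B e f :
  edge e \subset side b E B -> edge f \subset side (~~ b) E B -> c e != c f.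
Proof.
have disjB : [disjoint B & E :\: B].
  by rewrite -setI_eq0 setIDA setDIl setDv set0I.
case: b => /= eS fS; apply: c_proper; apply: disjointW eS fS _ => //.
by rewrite disjoint_sym.
Qed.

Lemma topsign_side E B : B \subset E -> 0 < maxcol E B ->
  exists2 e, edge e \subset side (topsign E B) E B & (c e).+1 = maxcol E B.
Proof.
move=> BE /maxcol_attained[e eI eM].
case: (boolP (topsign E B)) => [/existsP[f /andP[fB /eqP fM]]|]; first by exists f.
move=> /existsPn/(_ e); rewrite eM eqxx andbT => /negPf eB.
by exists e => //; move: eI; rewrite /inside eB.
Qed.

Lemma topsign_unique b E B e : B \subset E -> edge e \subset side b E B ->
  (c e).+1 = maxcol E B -> topsign E B = b.
Proof.
move=> BE eS eM; have [|f fS fM] := @topsign_side E B BE; first by rewrite -eM.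
have [//|nb] := eqVneq (topsign E B) b; have eb : topsign E B = ~~ b.
  by move: nb; case: topsign; case: (b).
have := side_disjoint eS; move=> /(_ f); rewrite -eb => /(_ fS)/eqP[].
by apply/succn_inj; rewrite eM fM.
Qed.

Lemma topsign_anti E B : B \subset E -> 0 < maxcol E B ->
  topsign E (E :\: B) = ~~ topsign E B.
Proof.
move=> BE m0; have [e eS eM] := topsign_side BE m0.
apply: (@topsign_unique _ _ _ e); rewrite ?subsetDl //.
  by rewrite sideD // negbK.
by rewrite maxcol_anti.
Qed.

(** * One-element extensions of sign vectors *)

Section Extension.
Variables (E B C : {set T}) (x : T).
Hypotheses (xE : x \notin E) (BE : B \subset E).
Hypotheses (CE : C \subset x |: E) (CB : C :\ x = B).

Lemma side_extend b : side b E B \subset side b (x |: E) C.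
Proof.
case: b => /=; first by rewrite -CB subsetDl.
apply/subsetP => y; rewrite !inE -CB !inE => /andP[+ yE].
have yx : y != x by apply: contraNneq xE => <-.
by rewrite (negPf yx) yE /= andbT.
Qed.

Lemma side_extend_notin b : x \notin side b (x |: E) C ->
  side b (x |: E) C \subset side b E B.
Proof.
move=> xS; apply/subsetP => y yS.
have yx : y != x by apply: contraTneq yS => ->.
by case: b xS yS => /= _; rewrite -CB !inE (negPf yx) //= => /andP[-> ->].
Qed.

Lemma inside_extend e : inside E B e -> inside (x |: E) C e.
Proof.
case/inside_side => b eS; apply: (@side_inside b).
exact: subset_trans eS (side_extend b).
Qed.

Lemma maxcol_extend : maxcol E B <= maxcol (x |: E) C.
Proof. by apply/bigmax_leqP => e eI; apply: maxcol_gt; apply: inside_extend. Qed.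

(** If the largest color did not grow, an edge attaining it in the smaller vector would still attain
    it on the same side and so fix the sign. *)
Lemma maxcol_extend_lt : topsign (x |: E) C != topsign E B ->
  gap < #|x |: E| -> maxcol E B < maxcol (x |: E) C.
Proof.
move=> ns large; rewrite ltn_neqAle maxcol_extend andbT.
apply: contraNneq ns => eqm; have m0 := maxcol_large CE large.
have [|e eS eM] := topsign_side BE; first by rewrite eqm.
apply/eqP; apply: (topsign_unique CE (subset_trans eS (side_extend _))).
by rewrite eM.
Qed.

End Extension.

Lemma altup_maxcol b k E B : B \subset E -> gap <= #|E| ->
  topsign E B = ~~ b -> altup topsign b k E B -> maxcol E B + k <= t.
Proof.
elim: k b E B => [|k IH] b E B BE large sE /=; first by rewrite addn0 maxcol_le.
case/exists_inP => x; rewrite inE => xE /existsP[C /and4P[CE /eqP CB /eqP sC uC]].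
have large' : gap < #|x |: E| by rewrite cardsU1 xE.
rewrite addnS -addSn; apply: leq_trans (IH _ _ _ CE (ltnW large') _ uC).
  rewrite leq_add2r; apply: maxcol_extend_lt => //.
  by rewrite sC sE; case: (b).
by rewrite negbK.
Qed.

Lemma altup_anti b k E B : B \subset E -> gap <= #|E| ->
  altup topsign b k E B -> altup topsign (~~ b) k E (E :\: B).
Proof.
elim: k b E B => [|k IH] b E B BE large //=.
case/exists_inP => x; rewrite inE => xE /existsP[C /and4P[CE /eqP CB /eqP sC uC]].
have large' : gap < #|x |: E| by rewrite cardsU1 xE.
apply/exists_inP; exists x; first by rewrite inE.
apply/existsP; exists ((x |: E) :\: C); apply/and4P; split.
- exact: subsetDl.
- by rewrite setDD1 CB setU1K.
- by rewrite topsign_anti ?maxcol_large // sC.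
- exact: IH (ltnW large') uC.
Qed.

Lemma altup_eq (s : {set T} -> {set T} -> bool) b k E B :
  (forall E B, B \subset E -> gap < #|E| -> s E B = topsign E B) ->
  gap <= #|E| -> altup s b k E B -> altup topsign b k E B.
Proof.
move=> seq; elim: k b E B => [|k IH] b E B large //=.
case/exists_inP => x; rewrite inE => xE /existsP[C /and4P[CE CB sC uC]].
have large' : gap < #|x |: E| by rewrite cardsU1 xE.
apply/exists_inP; exists x; first by rewrite inE.
by apply/existsP; exists C; rewrite CE CB -seq // sC IH // ltnW.
Qed.

(** An arbitrary antipodal choice: the sign of an element that depends on the support only. *)
Definition basesign E B := if [pick x in E] is Some x then x \in B else true.

Lemma basesign_anti E B : E != set0 -> basesign E (E :\: B) = ~~ basesign E B.
Proof.
rewrite /basesign; case: pickP => [x xE _|E0 /set0Pn[x]]; last by rewrite E0.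
by rewrite inE xE andbT.
Qed.

(* On sign vectors of size [gap] without edges the sign is chosen so that no
   alternating chain through them can be continued up to the top, unless both
   kinds of continuations exist. *)
Definition fansign E B :=
  if 0 < maxcol E B then topsign E B
  else if #|E| == gap then
    if altup topsign true t E B then true
    else if altup topsign false t E B then false else basesign E B
  else basesign E B.

(** Otherwise [fansign] is antipodal, and Fan's lemma gives an alternating chain with [t] members
    above size [gap]. An edge in its member of size [gap] would push [maxcol] beyond [t]; without
    edges, that member was given the first sign above it, against alternation. *)
Lemma two_chains : t <= #|T| ->
  exists E, exists B, [/\ #|E| = gap, B \subset E, maxcol E B = 0,
    altup topsign true t E B & altup topsign false t E B].
Proof.
move=> tT.
case: (boolP [exists E : {set T}, exists B : {set T}, [&& #|E| == gap, B \subset E,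
    maxcol E B == 0, altup topsign true t E B & altup topsign false t E B]]).
  by case/existsP=> E /existsP[B /and5P[/eqP ? ? /eqP ? ? ?]]; exists E, B.
move=> /existsPn none; exfalso.
have {}none E B : #|E| = gap -> B \subset E -> maxcol E B = 0 ->
    altup topsign true t E B -> altup topsign false t E B -> False.
  move=> cE BE m0 u1 u2; move: (none E) => /existsPn/(_ B)/negP; apply.
  by rewrite cE BE m0 u1 u2 !eqxx.
have s_anti E B : B \subset E -> E != set0 ->
    fansign E (E :\: B) = ~~ fansign E B.
  move=> BE E0; rewrite /fansign maxcol_anti //.
  case: posnP => [m0|m0]; last by rewrite topsign_anti.
  case: eqP => [cE|_]; last exact: basesign_anti.
  have ua b : altup topsign b t E (E :\: B) = altup topsign (~~ b) t E B.
    apply/idP/idP => [|u]; last by rewrite -[b]negbK altup_anti ?cE.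
    by move=> /altup_anti; rewrite setDDK // cE subsetDl; apply.
  rewrite !ua /=; have := none E B cE BE m0.
  case: (altup _ true); case: (altup _ false) => //= nn; first by case: nn.
  exact: basesign_anti.
have [E [B [cE BE pE uE]]] := fan_sign s_anti erefl (leq_subr t #|T|).
have {uE} uE : altup topsign (~~ odd gap) t E B.
  move: uE; rewrite subKn //; apply: altup_eq; rewrite ?cE // => E' B' BE' large.
  by rewrite /fansign maxcol_large.
(* The empty vector carries no sign, but it is its own antipode, so either kind of continuation
   yields the other. *)
have [g0|g_gt0] := posnP gap.
  have E0 : E = set0 by apply: cards0_eq; rewrite cE.
  have B0 : B = set0 by apply/eqP; rewrite -subset0 -E0.
  move: uE; rewrite g0 /= => uE; apply: (none E B) => //; last first.
    have /= := altup_anti BE _ uE; rewrite cE => /(_ (leqnn _)).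
    by rewrite E0 B0 setD0.
  rewrite /maxcol big_pred0 // => e; rewrite /inside E0 B0 setD0 orbb subset0.
  exact: negbTE.
have sE : fansign E B = odd gap.
  by move: pE g_gt0; case: gap => // k; rewrite altparS => /andP[/eqP].
have m0 : maxcol E B = 0.
  have [//|m0] := posnP (maxcol E B).
  move: sE; rewrite /fansign m0 => sE.
  have := @altup_maxcol _ _ _ _ BE _ _ uE; rewrite cE negbK sE.
  by move=> /(_ (leqnn _) erefl); rewrite -[X in _ <= X]add0n leq_add2r leqNgt m0.
move: (none E B cE BE m0) uE sE; rewrite /fansign m0 cE eqxx /=.
by case: (odd gap) => /= nn u; rewrite u; [case: altup nn => // /(_ isT u) | ].
Qed.

(** * Climbing the two chains in parallel *)

Section TwoChainsWalk.
Variables (E0 B0 : {set T}).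
Hypotheses (cE0 : #|E0| = gap) (BE0 : B0 \subset E0) (m0 : maxcol E0 B0 = 0).

Definition pure j x := forall e b, edge e \subset x |: side b E0 B0 -> c e = j.

(** Adding [x] on side [b] gives a vector large enough to contain an edge, and the other side is
    still edge-free. *)
Lemma pure_edge_ex x b : x \notin E0 ->
  exists e, edge e \subset x |: side b E0 B0.
Proof.
move=> xE; have large : gap < #|x |: E0| by rewrite cardsU1 xE cE0.
have none e : inside E0 B0 e -> False by move/maxcol_gt; rewrite m0.
case: b => /=.
  have [|e /orP[eS|eS]] := @inside_ex (x |: E0) (x |: B0) _ large.
  - by rewrite setUS.
  - by exists e.
  case: (none e); apply: (@side_inside false); apply: subset_trans eS _.
  by apply/subsetP => y; rewrite !inE; case: (y == x).
have [|e /orP[eS|eS]] := @inside_ex (x |: E0) B0 _ large.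
- exact: subset_trans BE0 (subsetUr _ _).
- by case: (none e); apply: (@side_inside true).
exists e; apply: subset_trans eS _.
by apply/subsetP => y; rewrite !inE; case: (y == x) => //=; case/andP=> ->.
Qed.

Lemma side_disjointU1 x y b e f : x \notin E0 -> y \notin E0 -> x != y ->
  edge e \subset x |: side b E0 B0 -> edge f \subset y |: side (~~ b) E0 B0 ->
  [disjoint edge e & edge f].
Proof.
move=> xE yE xy eS fS; apply: disjointW eS fS _.
have BS := subsetP BE0.
have xB : x \notin B0 by apply: contra xE; apply: BS.
have yB : y \notin B0 by apply: contra yE; apply: BS.
apply/pred0P => z /=; case: b; rewrite /= !inE.
  have [->|_] := eqVneq z x; first by rewrite (negPf xy) (negPf xE) andbF.
  by have [->|_] := eqVneq z y; rewrite ?(negPf yB) //=; case: (z \in B0).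
have [->|_] := eqVneq z x; first by rewrite (negPf xy) (negPf xB).
have [->|_] := eqVneq z y; first by rewrite (negPf yE) andbF.
by rewrite /=; case: (z \in B0); rewrite ?andbF.
Qed.

Definition stage k b E B :=
  [/\ B \subset E, forall b', side b' E0 B0 \subset side b' E B,
      maxcol E B = t - k, 0 < maxcol E B -> topsign E B = ~~ b
    & altup topsign b k E B].

(** The step raises [maxcol], and the [k] raises still to come leave room for exactly one. An edge
    of the new largest color lies on side [b] and must use [x], so [x] joins that side. *)
Lemma stage_step k b E B : E0 \subset E -> k < t -> stage k.+1 b E B ->
  exists x, exists C, [/\ x \notin E, stage k (~~ b) (x |: E) C
    & forall e, edge e \subset x |: side b E0 B0 -> c e < t - k].
Proof.
move=> E0E kt [BE S0 mE sE /=].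
case/exists_inP => x; rewrite inE => xE /existsP[C /and4P[CE /eqP CB /eqP sC uC]].
have large : gap <= #|E| by rewrite -cE0 subset_leq_card.
have large' : gap < #|x |: E| by rewrite cardsU1 xE.
have mlt : maxcol E B < maxcol (x |: E) C.
  have [->|m_gt0] := posnP (maxcol E B); first exact: maxcol_large.
  by apply: maxcol_extend_lt => //; rewrite sE // sC; case: (b).
have mC : maxcol (x |: E) C = t - k.
  apply/eqP; rewrite eqn_leq -(subnSK kt) -mE mlt andbT.
  rewrite mE subnSK // leq_subRL ?(ltnW kt) // addnC.
  by apply: altup_maxcol uC; rewrite ?negbK // ltnW.
exists x, C; split=> //.
  split=> // [b'|_]; last by rewrite sC negbK.
  exact: subset_trans (S0 b') (side_extend xE CB b').
have xS : x \in side b (x |: E) C.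
  have [e eS eM] := topsign_side CE (leq_ltn_trans (leq0n _) mlt).
  rewrite sC in eS; have [//|xS] := boolP (x \in side b (x |: E) C).
  have /side_inside/maxcol_gt := subset_trans eS (side_extend_notin CB xS).
  by move=> em; move: mlt; rewrite -eM ltnS leqNgt em.
move=> e eS; rewrite -mC; apply/maxcol_gt/(@side_inside b).
apply: subset_trans eS _; rewrite subUset sub1set xS.
exact: subset_trans (S0 b) (side_extend xE CB b).
Qed.

Lemma stage_walk k b E1 B1 E2 B2 : k <= t -> E0 \subset E1 -> E0 \subset E2 ->
  stage k b E1 B1 -> stage k (~~ b) E2 B2 ->
  (forall j, j < t - k ->
     exists x, [/\ x \in E1, x \in E2, x \notin E0 & pure j x]) ->
  forall j, j < t -> exists2 x, x \notin E0 & pure j x.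
Proof.
elim: k b E1 B1 E2 B2 => [|k IH] b E1 B1 E2 B2 kt E01 E02 st1 st2 pr.
  by move=> j; rewrite -[t]subn0 => /pr[x [_ _ xE px]]; exists x.
have [x1 [C1 [xE1 {}st1 lt1]]] := stage_step E01 kt st1.
have [x2 [C2 [xE2 {}st2 lt2]]] := stage_step E02 kt st2.
have xE01 : x1 \notin E0 by apply: contra xE1; apply: (subsetP E01).
have xE02 : x2 \notin E0 by apply: contra xE2; apply: (subsetP E02).
(* A smaller color [j] is excluded: an earlier pure element [y], distinct from [x], carries an edge
   of color [j] on the opposite side, disjoint from [e]. *)
have exact_color x b' e : x \notin E0 -> x \notin E1 \/ x \notin E2 ->
    edge e \subset x |: side b' E0 B0 -> c e < t - k -> c e = t - k.+1.
  move=> xE0 xE12 eS; rewrite -subnSK // ltnS leq_eqVlt => /orP[/eqP //|].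
  move=> /pr[y [yE1 yE2 yE0 py]].
  have xy : x != y by case: xE12; apply: contraNneq => ->.
  have [f fS] := pure_edge_ex (~~ b') yE0.
  by have := c_proper (side_disjointU1 xE0 yE0 xy eS fS); rewrite (py f _ fS) eqxx.
have c1 e : edge e \subset x1 |: side b E0 B0 -> c e = t - k.+1.
  by move=> eS; apply: exact_color eS (lt1 _ eS) => //; left.
have c2 e : edge e \subset x2 |: side (~~ b) E0 B0 -> c e = t - k.+1.
  by move=> eS; apply: exact_color eS (lt2 _ eS) => //; right.
(* Distinct elements would give disjoint edges of the same color. *)
have x12 : x1 = x2.
  have [//|x12] := eqVneq x1 x2.
  have [e eS] := pure_edge_ex b xE01; have [f fS] := pure_edge_ex (~~ b) xE02.
  have := c_proper (side_disjointU1 xE01 xE02 x12 eS fS).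
  by rewrite (c1 e eS) (c2 f fS) eqxx.
subst x2; apply: (IH (~~ b) _ C1 _ C2 (ltnW kt)) st1 st2 _.
- exact: subset_trans E01 (subsetUr _ _).
- exact: subset_trans E02 (subsetUr _ _).
move=> j; rewrite -subnSK // ltnS leq_eqVlt => /orP[/eqP ->|/pr].
  exists x1; rewrite !setU11; split=> // e b' eS.
  by case: (eqVneq b' b) eS => [->|nb] eS; [exact: c1 | apply: c2];
     move: nb eS; case: (b'); case: (b).
by case=> x [xF1 xF2 xF0 px]; exists x; rewrite !in_setU1 xF1 xF2 !orbT.
Qed.

End TwoChainsWalk.

Lemma colorful_biclique : t <= #|T| ->
  exists e f : 'I_t -> G, [/\ forall i, c (e i) = i, forall i, c (f i) = i
    & forall i j, i != j -> [disjoint edge (e i) & edge (f j)]].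
Proof.
move=> tT; have [E [B [cE BE m0 u1 u2]]] := two_chains tT.
have pr : forall j, j < t -> exists2 x, x \notin E & pure E B j x.
  apply: (@stage_walk E B cE BE m0 t true E B E B) => //.
  - by split; rewrite ?m0 ?subnn.
  - by split; rewrite ?m0 ?subnn.
  by move=> j; rewrite subnn.
have /fin_all_exists[x xP] : forall i : 'I_t, exists y, y \notin E /\ pure E B i y.
  by move=> i; have [y ? ?] := pr i (ltn_ord i); exists y.
have ef b i : exists e, edge e \subset x i |: side b E B.
  by apply: pure_edge_ex => //; have [] := xP i.
have [e eS] := fin_all_exists (ef true).
have [f fS] := fin_all_exists (ef false).
exists e, f; split=> [i|i|i j ij].
- by have [_ px] := xP i; apply: px (eS i).
- by have [_ px] := xP i; apply: px (fS i).
have [xiE px] := xP i; have [xjE py] := xP j.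
apply: (side_disjointU1 BE xiE xjE _ (eS i) (fS j)).
apply: contraNneq ij => xij; apply/eqP/val_inj => /=.
by have := eS i; rewrite xij => eSi; rewrite -(px _ _ (eS i)) (py _ _ eSi).
Qed.

End ColorfulSubgraph.

(** * Circular colorings *)

Lemma cd2_le (H : hypergraph) : cd2 H <= #|hvert H|.
Proof.
rewrite /cd2; case: ex_minnP => n /existsP[U /andP[/eqP <- _]] _.
exact: max_card.
Qed.

(** If no edge lay inside, coloring [E] by membership in [B] would make [~: E] a witness smaller
    than the defect. *)
Lemma cd2_inside (H : hypergraph) (E B : {set hvert H}) :
  B \subset E -> #|hvert H| - cd2 H < #|E| ->
  exists e : KG H, inside val E B e.
Proof.
move=> BE; rewrite /cd2; case: ex_minnP => n _ n_min large.
have [/existsP//|/existsPn none] := boolP [exists e : KG H, inside val E B e].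
suff: n <= #|~: E|.
  by have := cardsC E; lia.
apply: n_min; apply/existsP; exists (~: E); rewrite eqxx /cd2_witness setCK /=.
apply/existsP; exists [ffun x => val x \in B].
apply/forall_inP => e; rewrite inE => /andP[eH].
rewrite setI_eq0 disjoints_subset setCK => eE.
have /norP[eB eEB] := none (exist _ e eH).
have [x xe xB] := subsetPn eB; have [y ye yB] := subsetPn eEB.
have yB' : y \in B by move: yB; rewrite inE (subsetP eE) // andbT negbK.
have xE := subsetP eE x xe; have yE := subsetP eE y ye.
apply/existsP; exists (exist _ x xE).
apply/existsP; exists (exist _ y yE).
by rewrite !ffunE /= xe ye (negPf xB) yB'.
Qed.

Lemma divn_dist_neq (q a b : nat) : 0 < q -> q <= `|a - b|%N -> a %/ q != b %/ q.
Proof.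
move=> q0 qab; apply: contraTneq qab => eqd; rewrite -ltnNge.
have := divn_eq a q; have := divn_eq b q; rewrite eqd.
by have := ltn_pmod a q0; have := ltn_pmod b q0; lia.
Qed.

Lemma pq_coloring_ratio (H : hypergraph) (p q : nat) (c : KG H -> nat) :
  0 < cd2 H -> 1 <= q <= p -> pq_coloring p q c -> cd2 H * q <= p.
Proof.
move=> t0 /andP[q0 qp] [c_range c_adj]; rewrite leqNgt; apply/negP => ptq.
pose k v := (c v).-1 %/ q.
have k_lt v : k v < cd2 H by rewrite /k ltn_divLR //; have := c_range v; lia.
have k_proper (u v : KG H) : [disjoint val u & val v] -> k u != k v.
  move=> /(c_adj u v)/andP[qd _]; apply: divn_dist_neq => //.
  by have := c_range u; have := c_range v; lia.
have edge0 (e : KG H) : val e != set0.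
  by apply: contraNneq (hedges_neq0 H) => <-; apply: (valP e).
have [e [f [ke kf ef]]] :=
  colorful_biclique edge0 k_lt k_proper (@cd2_inside H) (cd2_le H).
have c_ltn u v : sadj u v -> k u < k v -> c u + q <= c v.
  move=> /c_adj/andP[qd _]; rewrite ltnNge => kuv.
  suff : c u < c v by lia.
  by rewrite ltnNge; apply: contra kuv => cvu; apply: leq_div2r; lia.
case: (cd2 H) t0 ptq e f ke kf ef {k_lt} => // m _ ptq e f ke kf ef.
(* The final comparison needs two distinct indices, 0 and [m]. *)
have m_gt0 : 0 < m.
  by rewrite lt0n; apply: contraTneq ptq => ->; rewrite mul1n -leqNgt.
have key i : i <= m ->
    c (e ord0) + c (f ord0) + 2 * q * i <= c (e (inord i)) + c (f (inord i)).
  elim: i => [|i IH] im.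
    have -> : inord 0 = ord0 :> 'I_m.+1 by apply: val_inj; rewrite /= inordK.
    by lia.
  have ni : inord i != inord i.+1 :> 'I_m.+1 by rewrite -val_eqE /= !inordK; lia.
  have ki : k (e (inord i)) < k (f (inord i.+1)) by rewrite ke kf !inordK; lia.
  have ki' : k (f (inord i)) < k (e (inord i.+1)) by rewrite ke kf !inordK; lia.
  have := c_ltn _ _ (ef _ _ ni) ki; rewrite eq_sym in ni.
  have ef' := ef _ _ ni; rewrite disjoint_sym in ef'.
  have := c_ltn _ _ ef' ki'; have := IH (ltnW im); lia.
(* The sum grows by at least [2 * q * m]; regrouped crosswise it is two differences along edges,
   each at most [p - q], while [p < m.+1 * q]. *)
have := key m (leqnn m).
have nm : inord m != ord0 :> 'I_m.+1 by rewrite -val_eqE /= inordK; lia.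
have /c_adj/andP[_] := ef _ _ nm; rewrite eq_sym in nm.
have /c_adj/andP[_] := ef _ _ nm.
nia.
Qed.

Theorem corollary2 (R : realType) (H : hypergraph) :
  hedges H != set0 ->
  chi (KG H) = cd2 H ->
  ((chi (KG H))%:R = chi_c R (KG H) :> R)%R.
Proof.
move=> /set0Pn[e0 e0H] chiE.
have : colorable (KG H) (chi (KG H)) by rewrite /chi; case: ex_minnP.
rewrite chiE => /existsP[c0 /forallP c0P].
have c0_proper (u v : KG H) : sadj u v -> c0 u != c0 v.
  by move=> uv; have /forallP/(_ v)/implyP/(_ uv) := c0P u.
have t0 : 0 < cd2 H by apply: leq_ltn_trans (ltn_ord (c0 (exist _ e0 e0H))).
rewrite /chi_c; set A := (X in inf X).
(* Shifting a proper coloring to start at 1 gives a coloring with [q = 1], so the infimum is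
   attained. *)
have At : A (cd2 H)%:R%R.
  exists (cd2 H), 1; split; rewrite ?t0 //; last by rewrite GRing.divr1.
  exists (fun v => (c0 v).+1); split=> [v|u v /c0_proper]; first exact: ltn_ord.
  rewrite -val_eqE /=; have := ltn_ord (c0 u); have := ltn_ord (c0 v).
  move: (nat_of_ord (c0 u)) (nat_of_ord (c0 v)) => a b ? ? ab.
  by apply/andP; split; lia.
have lbA : classical_sets.lbound A (cd2 H)%:R%R.
  move=> _ [p [q [pq [c cP] ->]]]; have [q0 _] := andP pq.
  rewrite Num.Theory.ler_pdivlMr ?Num.Theory.ltr0n // -GRing.natrM Num.Theory.ler_nat.
  exact: pq_coloring_ratio cP.
apply: Order.POrderTheory.le_anti; apply/andP; split.
  by apply: lb_le_inf => //; exists (cd2 H)%:R%R.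
by apply: ge_inf => //; exists (cd2 H)%:R%R.
Qed.
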